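(* Let $r,s$ be positive integers, let $a_1,\dots,a_r,b_1,\dots,b_s,\alpha,\beta,z$ be as in the context, let $\mu$ be an arbitrary order with $\Re(\mu)>0$, and let $\nu$ be a real or complex number. Then the left-hand Kober fractional $q$-integral and $q$-derivative of the ${}_rR_{s,q}$ function (as a function of $z$) are $$I_q^{\nu,\mu}\left[{}_rR_{s,q}(a_1,\dots,a_r;b_1,\dots,b_s;\alpha,\beta;z)\right]=\frac{\Gamma_q(\nu+1)}{\Gamma_q(\nu+\mu+1)}\;{}_{r+1}R_{s+1,q}\left(a_1,\dots,a_r,q^{\nu+1};b_1,\dots,b_s,q^{\nu+\mu+1};\alpha,\beta;z\right)$$ and $$D_q^{\nu,\mu}\left[{}_rR_{s,q}(a_1,\dots,a_r;b_1,\dots,b_s;\alpha,\beta;z)\right]=\frac{\Gamma_q(\nu+\mu+1)}{\Gamma_q(\nu+1)}\;{}_{r+1}R_{s+1,q}\left(a_1,\dots,a_r,q^{\nu+\mu+1};b_1,\dots,b_s,q^{\nu+1};\alpha,\beta;z\right).$$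
   Context: Let $q\in\mathbb{C}$, $0<|q|<1$; complex powers are formed with fixed branches. $(a;q)_0=1$, $(a;q)_n=\prod_{i=0}^{n-1}(1-aq^i)$ for $n\ge1$, $(a;q)_\infty=\prod_{i\ge0}(1-aq^i)$, and $(y)_\lambda=(y;q)_\lambda=\frac{(y;q)_\infty}{(yq^\lambda;q)_\infty}$ for $\lambda\in\mathbb{C}$; $[\lambda]_q=\frac{1-q^\lambda}{1-q}$. $\Gamma_q(x)=\frac{(q;q)_\infty}{(q^x;q)_\infty}(1-q)^{1-x}$, with $1/\Gamma_q(x)$ read as $0$ at its poles. For complex parameters the basic function ${}_rR_{s,q}$ is $${}_rR_{s,q}(a_1,\dots,a_r;b_1,\dots,b_s;\alpha,\beta;z)=\sum_{\ell=0}^\infty\frac{z^\ell(-1)^{(1+s-r)\ell}q^{(1+s-r)\binom{\ell}{2}}}{(q;q)_\ell\,\Gamma_q(\ell\alpha+\beta)}\,\frac{\prod_{i=1}^r(a_i;q)_\ell}{\prod_{j=1}^s(b_j;q)_\ell}.$$ Standing assumption: $a_iq^\ell\ne1$ and $b_jq^\ell\neq1$ for all $i,j$ and all integers $\ell\ge0$. The Jackson integral is $\int_0^xf(t)\,\mathrm{d}_qt=(1-q)x\sum_{n\ge0}q^nf(xq^n)$; the $q$-derivative is $(D_qf)(x)=\frac{f(x)-f(qx)}{(1-q)x}$. The left-hand Kober fractional $q$-integral and $q$-derivative are $$I_q^{\nu,\mu}f(x)=\frac{x^{-\nu-1}}{\Gamma_q(\mu)}\int_0^x\left(\tfrac{tq}{x}\right)_{\mu-1}t^\nu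 f(t)\,\mathrm{d}_qt\quad(\Re(\mu)>0),$$ $$D_q^{\nu,\mu}f(x)=\prod_{i=1}^m\left([\nu+i]_q+xq^{\nu+i}D_q\right)I_q^{\nu+\mu,m-\mu}f(x),\qquad m=[\Re(\mu)]+1,\ m\in\mathbb{N},$$ where $[\Re(\mu)]$ is the integer part.
   Formalization: The fixed branches are required to satisfy log(z q^n) = log z + n log q on the points z q^n (automatic for 0<q<1, principal branch); z is nonzero, the series R and the Jackson integral at z converge, and q^mu (resp. q^(m-mu)) times q^l is never 1. *)

(* Defs.v *)
From Stdlib Require Import Reals ZArith List.
From Coquelicot Require Import Coquelicot.
Open Scope C_scope.

Definition Cexp (w : C) : C :=
  (exp (Re w) * cos (Im w), exp (Re w) * sin (Im w))%R.

(** Complex powers are taken with respect to a fixed choice [Lg] of a logarithm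
    on C \ {0}; [Lg] is an argument of everything that involves such a power. *)
Definition cpow (Lg : C -> C) (w lam : C) : C := Cexp (lam * Lg w).

(** [Lg] is a logarithm on C \ {0}, and along the lattice z, zq, zq^2, ..., where
    the operators below sample t^nu, it stays on one sheet, so that
    (z q^n)^nu = z^nu (q^n)^nu.  For 0 < q < 1 the principal logarithm has this
    property for every z <> 0; for other q one needs, for example, a logarithm
    cut along a spiral invariant under multiplication by q. *)
Definition log_branch (Lg : C -> C) (q z : C) : Prop :=
  (forall t : C, t <> 0 -> Cexp (Lg t) = t) /\
  (forall n : nat, Lg (z * q ^ n) = Lg z + RtoC (INR n) * Lg q).

Definition Cpowz (w : C) (k : Z) : C :=
  match k with
  | Z0 => 1
  | Zpos p => w ^ Pos.to_nat p
  | Zneg p => / w ^ Pos.to_nat p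
  end.

Definition Csummable (u : nat -> C) : Prop :=
  @ex_series C_AbsRing C_NormedModule u.

(** The sum of [u] when [Csummable u] holds, unspecified otherwise. *)
Definition CSeries (u : nat -> C) : C :=
  (Series (fun n => Re (u n)), Series (fun n => Im (u n))).

Fixpoint qpoch (q y : C) (n : nat) : C :=
  match n with
  | O => 1
  | S k => qpoch q y k * (1 - y * q ^ k)
  end.

Definition qpoch_inf (q y : C) : C :=
  (real (Lim_seq (fun n => Re (qpoch q y n))),
   real (Lim_seq (fun n => Im (qpoch q y n)))).

Definition qpoch_cplx (Lg : C -> C) (q y lam : C) : C :=
  qpoch_inf q y / qpoch_inf q (y * cpow Lg q lam).

Definition qnum (Lg : C -> C) (q lam : C) : C := (1 - cpow Lg q lam) / (1 - q).

(** At a pole the denominator vanishes; as [/ 0 = 0] in [C], the value given here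
    is then 0, and so is its inverse, which is the usual reading of 1/Gamma_q. *)
Definition qGamma (Lg : C -> C) (q x : C) : C :=
  qpoch_inf q q / qpoch_inf q (cpow Lg q x) * cpow Lg (1 - q) (1 - x).

(** c q^l <> 1 for all l >= 0, i.e. no factor of (c;q)_l or (c;q)_oo vanishes. *)
Definition qregular (q c : C) : Prop := forall l : nat, c * q ^ l <> 1.

Definition qpoch_list (q : C) (cs : list C) (l : nat) : C :=
  fold_right (fun c acc => qpoch q c l * acc) 1 cs.

(** The exponent 1 + s - r may be negative, hence the integer powers. *)
Definition qR_term (Lg : C -> C) (q : C) (a b : list C) (alpha beta z : C)
    (l : nat) : C :=
  let e := (1 + Z.of_nat (length b) - Z.of_nat (length a))%Z in
  z ^ l * Cpowz (- (1)) (e * Z.of_nat l)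
    * Cpowz q (e * Z.of_nat (l * (l - 1) / 2)%nat)
    / (qpoch q q l * qGamma Lg q (RtoC (INR l) * alpha + beta))
  * (qpoch_list q a l / qpoch_list q b l).

Definition qR (Lg : C -> C) (q : C) (a b : list C) (alpha beta z : C) : C :=
  CSeries (qR_term Lg q a b alpha beta z).

Definition jackson_integrable (q : C) (f : C -> C) (x : C) : Prop :=
  Csummable (fun n => q ^ n * f (x * q ^ n)).

Definition jackson (q : C) (f : C -> C) (x : C) : C :=
  (1 - q) * x * CSeries (fun n => q ^ n * f (x * q ^ n)).

Definition qderiv (q : C) (f : C -> C) (x : C) : C :=
  (f x - f (q * x)) / ((1 - q) * x).

Definition kober_integrand (Lg : C -> C) (q nu mu : C) (f : C -> C) (x t : C) : C :=
  qpoch_cplx Lg q (t * q / x) (mu - 1) * cpow Lg t nu * f t.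

Definition kober_integral (Lg : C -> C) (q nu mu : C) (f : C -> C) (x : C) : C :=
  cpow Lg x (- nu - 1) / qGamma Lg q mu
  * jackson q (kober_integrand Lg q nu mu f x) x.

Definition kober_factor (Lg : C -> C) (q nu : C) (i : nat) (f : C -> C) (x : C) : C :=
  qnum Lg q (nu + RtoC (INR i)) * f x
  + x * cpow Lg q (nu + RtoC (INR i)) * qderiv q f x.

(** The composite of the factors i = 1, ..., m, with i = 1 outermost. *)
Fixpoint kober_factors (Lg : C -> C) (q nu : C) (m : nat) (f : C -> C) : C -> C :=
  match m with
  | O => f
  | S k => kober_factors Lg q nu k (kober_factor Lg q nu (S k) f)
  end.

Definition kober_order (mu : C) : nat := Z.to_nat (Int_part (Re mu) + 1).

Definition kober_derivative (Lg : C -> C) (q nu mu : C) (f : C -> C) : C -> C :=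
  let m := kober_order mu in
  kober_factors Lg q nu m
    (kober_integral Lg q (nu + mu) (RtoC (INR m) - mu) f).

(* Main.v *)
Require Import Defs.
From Stdlib Require Import Reals ZArith List Lra Lia Classical.
From Coquelicot Require Import Coquelicot.
Open Scope C_scope.

(** The function R is a power series [f(x) = sum_l c_l x^l], and both operators act
    on it through its values on the lattice z, zq, zq^2, ..., so everything is done
    with the numbers [d_l = c_l z^l] and the values
    [f(z q^n) = sum_l d_l (q^n)^l].

    On that lattice the kernel [(q^(n+1); q)_(mu-1)] is, up to a constant factor, the
    coefficient [w_n = (q^mu; q)_n / (q; q)_n] of the q-binomial theorem
    ([kober_integrand_lattice]).  Hence the Kober integral at z is a constant times
    [sum_n w_n y^n f(z q^n)] with [y = q^(nu+1)].  Summing over n first gives for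
    each l the q-binomial series [sum_n w_n (y q^l)^n], whose value
    [(q^mu y q^l; q)_oo / (y q^l; q)_oo] equals
    [(y; q)_l / (q^mu y; q)_l] times a factor independent of l: these are the two
    parameters that the theorem adds, and the constants combine to a quotient of
    q-Gamma values ([kober_integral_power_series]).

    Two points of convergence need care.  The q-binomial series requires
    [|y q^l| < 1] for every l with [d_l <> 0], although [|y|] itself may exceed 1.
    This follows from Jackson integrability: if N is the first index with
    [d_N <> 0], then [f(z q^n)] is asymptotic to [d_N q^(nN)] and [w_n] has a nonzero
    limit, so the terms of the Jackson sum can tend to 0 only if [|y q^N| < 1]
    ([ratios_below_one_of_vanishing_terms]).  Moreover [sum_l d_l] is only known to
    converge, perhaps conditionally.  Only the n = 0 part of the double sum is
    affected by that, since for n >= 1 the factor [q^(nl)] makes it absolutely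
    convergent; removing finitely many n at once leaves a remainder bounded by
    [K rho^N |q|^l] with [rho < 1], which justifies the interchange
    ([summation_interchange]).

    For the derivative, the operator [ [nu+i] + x q^(nu+i) D_q ] is simply
    [g |-> (g(x) - q^(nu+i) g(qx)) / (1-q)], so it multiplies the l-th term of a power
    series by [(1 - q^(nu+i+l)) / (1-q)] ([kober_factors_power_series]).  The m factors
    together contribute [(q^(nu+1+l); q)_m / (1-q)^m], which turns the parameter
    [q^(nu+m+1)] produced by the inner Kober integral into [q^(nu+1)]
    ([kober_derivative_power_series]). *)

(** * Limits and series of complex numbers *)

(** Limits are expressed through [Cmod] alone, which turns every estimate into a real
    squeeze; [csum_clim] links this to the filter-based series of [Csummable]. *)
Definition clim (u : nat -> C) (l : C) : Prop :=
  is_lim_seq (fun n => Cmod (u n - l)) 0.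

Definition csum (u : nat -> C) (l : C) : Prop :=
  @is_series C_AbsRing C_NormedModule u l.

Definition psum (u : nat -> C) (n : nat) : C :=
  @sum_n C_AbelianMonoid u n.

Lemma psum_0 (u : nat -> C) : psum u 0 = u 0%nat.
Proof. unfold psum. now rewrite sum_O. Qed.

Lemma psum_S (u : nat -> C) (n : nat) : psum u (S n) = psum u n + u (S n).
Proof. unfold psum. now rewrite sum_Sn. Qed.

Lemma squeeze_0 (u v : nat -> R) :
  (forall n, (0 <= u n <= v n)%R) -> is_lim_seq v 0 -> is_lim_seq u 0.
Proof.
  intros H Hv.
  apply is_lim_seq_le_le with (u := fun _ => 0%R) (w := v); auto.
  apply is_lim_seq_const.
Qed.

Lemma csum_clim (u : nat -> C) (l : C) : csum u l <-> clim (psum u) l.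
Proof.
  unfold csum, is_series, clim.
  rewrite (filterlim_locally_ball_norm (K := C_AbsRing) (U := C_NormedModule)
             (F := eventually)).
  split; intros H.
  - apply is_lim_seq_spec. intros eps. destruct (H eps) as [N HN].
    exists N. intros n Hn. specialize (HN n Hn).
    change (Cmod (psum u n - l) < eps)%R in HN.
    rewrite Rminus_0_r, Rabs_pos_eq by apply Cmod_ge_0. exact HN.
  - intros eps. apply is_lim_seq_spec in H. destruct (H eps) as [N HN].
    exists N. intros n Hn. specialize (HN n Hn).
    rewrite Rminus_0_r, Rabs_pos_eq in HN by apply Cmod_ge_0. exact HN.
Qed.

Lemma clim_ext (u v : nat -> C) (l : C) :
  (forall n, u n = v n) -> clim u l -> clim v l.
Proof.
  intros H. apply is_lim_seq_ext. intros n. now rewrite H.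
Qed.

Lemma clim_const (c : C) : clim (fun _ => c) c.
Proof.
  unfold clim. apply is_lim_seq_ext with (fun _ => 0%R).
  - intros _. replace (c - c) with (RtoC 0) by ring. now rewrite Cmod_0.
  - apply is_lim_seq_const.
Qed.

Lemma clim_plus (u v : nat -> C) (l m : C) :
  clim u l -> clim v m -> clim (fun n => u n + v n) (l + m).
Proof.
  intros Hu Hv. unfold clim.
  apply squeeze_0 with (fun n => (Cmod (u n - l) + Cmod (v n - m))%R).
  - intros n. split; [apply Cmod_ge_0|].
    replace (u n + v n - (l + m)) with ((u n - l) + (v n - m)) by ring.
    apply Cmod_triangle.
  - rewrite <- (Rplus_0_r 0). now apply is_lim_seq_plus'.
Qed.

Lemma clim_mult (u v : nat -> C) (l m : C) :
  clim u l -> clim v m -> clim (fun n => u n * v n) (l * m).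
Proof.
  intros Hu Hv. unfold clim.
  apply squeeze_0 with (fun n => (Cmod (u n - l) * Cmod (v n - m)
     + (Cmod l * Cmod (v n - m) + Cmod m * Cmod (u n - l)))%R).
  - intros n. split; [apply Cmod_ge_0|].
    replace (u n * v n - l * m)
      with ((u n - l) * (v n - m) + (l * (v n - m) + m * (u n - l))) by ring.
    rewrite <- !Cmod_mult.
    eapply Rle_trans; [apply Cmod_triangle|].
    apply Rplus_le_compat_l, Cmod_triangle.
  - replace 0%R with (0 * 0 + (Cmod l * 0 + Cmod m * 0))%R by ring.
    apply is_lim_seq_plus'; [now apply is_lim_seq_mult'|].
    apply is_lim_seq_plus';
      (apply is_lim_seq_mult'; [apply is_lim_seq_const|assumption]).
Qed.

Lemma clim_scal (c : C) (u : nat -> C) (l : C) :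
  clim u l -> clim (fun n => c * u n) (c * l).
Proof. apply clim_mult, clim_const. Qed.

Lemma clim_unique (u : nat -> C) (l m : C) : clim u l -> clim u m -> l = m.
Proof.
  intros Hl Hm.
  assert (H := clim_plus _ _ _ _ Hl (clim_scal (-(1)) _ _ Hm)).
  assert (E : Cmod (l + -(1) * m) = 0%R).
  { apply is_lim_seq_unique in H.
    rewrite (Lim_seq_ext _ (fun _ => Cmod (l + -(1) * m))), Lim_seq_const in H.
    - now injection H.
    - intros n. rewrite <- Cmod_opp. f_equal. ring. }
  apply Cmod_eq_0 in E.
  replace l with ((l + -(1) * m) + m) by ring. rewrite E. ring.
Qed.

Lemma clim_incr (u : nat -> C) (l : C) :
  clim u l <-> clim (fun n => u (S n)) l.
Proof. apply (is_lim_seq_incr_1 (fun n => Cmod (u n - l))). Qed.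

Lemma clim_incr_n (u : nat -> C) (k : nat) (l : C) :
  clim u l <-> clim (fun n => u (n + k)%nat) l.
Proof. apply (is_lim_seq_incr_n (fun n => Cmod (u n - l))). Qed.

Lemma clim_Cmod (u : nat -> C) (l : C) :
  clim u l -> is_lim_seq (fun n => Cmod (u n)) (Cmod l).
Proof.
  intros H.
  apply is_lim_seq_le_le with (u := fun n => (Cmod l - Cmod (u n - l))%R)
                              (w := fun n => (Cmod l + Cmod (u n - l))%R).
  - intros n. split.
    + assert (T := Cmod_triangle (u n) (-(u n - l))).
      rewrite Cmod_opp in T.
      replace (u n + - (u n - l)) with l in T by ring. lra.
    + assert (T := Cmod_triangle l (u n - l)).
      replace (l + (u n - l)) with (u n) in T by ring. exact T.
  - replace (Finite (Cmod l)) with (Finite (Cmod l - 0)) by (f_equal; ring).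
    apply is_lim_seq_minus'; [apply is_lim_seq_const|exact H].
  - replace (Finite (Cmod l)) with (Finite (Cmod l + 0)) by (f_equal; ring).
    apply is_lim_seq_plus'; [apply is_lim_seq_const|exact H].
Qed.

Lemma clim_ge (u : nat -> C) (l : C) (M : R) :
  clim u l -> (forall n, (M <= Cmod (u n))%R) -> (M <= Cmod l)%R.
Proof.
  intros H HM. apply clim_Cmod in H.
  exact (is_lim_seq_le (fun _ => M) _ M (Cmod l) HM (is_lim_seq_const M) H).
Qed.

Lemma clim_inv (u : nat -> C) (l : C) :
  l <> 0 -> (forall n, u n <> 0) -> clim u l -> clim (fun n => / u n) (/ l).
Proof.
  intros Hl Hu H. unfold clim.
  apply is_lim_seq_ext with
    (fun n => (Cmod (u n - l) * / (Cmod (u n) * Cmod l))%R).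
  - intros n.
    rewrite <- Cmod_mult, <- Cmod_inv, <- Cmod_mult by now apply Cmult_neq_0.
    rewrite <- Cmod_opp. f_equal. field. split; auto.
  - assert (Hp : (0 < Cmod l)%R) by now apply Cmod_gt_0.
    replace 0%R with (0 * / (Cmod l * Cmod l))%R by ring.
    apply is_lim_seq_mult'; [exact H|].
    apply (is_lim_seq_inv (fun n => Cmod (u n) * Cmod l)%R (Cmod l * Cmod l)%R).
    + apply is_lim_seq_mult'; [now apply clim_Cmod|apply is_lim_seq_const].
    + intros E. injection E as E. nra.
Qed.

Lemma clim_bounded (u : nat -> C) (l : C) :
  clim u l -> exists M : R, (0 <= M)%R /\ forall n, (Cmod (u n) <= M)%R.
Proof.
  intros H. apply clim_Cmod in H.
  destruct (maj_by_pos (fun n => Cmod (u n))) as [M [HM0 HM]].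
  { exists (Cmod l). now apply is_lim_seq_Reals. }
  exists M. split; [lra|]. intros n.
  eapply Rle_trans; [apply Rle_abs|apply HM].
Qed.

(** [qpoch_inf] and [CSeries] are defined componentwise; this is the bridge to them. *)
Lemma clim_proj (u : nat -> C) (l : C) :
  clim u l ->
  is_lim_seq (fun n => Re (u n)) (Re l) /\ is_lim_seq (fun n => Im (u n)) (Im l).
Proof.
  intros H.
  split; apply is_lim_seq_spec; intros eps; apply is_lim_seq_spec in H;
    destruct (H eps) as [N HN]; exists N; intros n Hn; specialize (HN n Hn);
    rewrite Rminus_0_r, Rabs_pos_eq in HN by apply Cmod_ge_0;
    eapply Rle_lt_trans; [|exact HN| |exact HN];
    (eapply Rle_trans; [|apply Rmax_Cmod]).
  - apply (Rmax_l (Rabs (fst (u n - l)))).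
  - apply (Rmax_r (Rabs (fst (u n - l)))).
Qed.

Lemma csum_Csummable (u : nat -> C) (l : C) : csum u l -> Csummable u.
Proof. intros H. now exists l. Qed.

Lemma csum_CSeries (u : nat -> C) (l : C) : csum u l -> CSeries u = l.
Proof.
  intros H. apply csum_clim, clim_proj in H. destruct H as [Hr Hi].
  unfold CSeries. destruct l as [lr li]. f_equal; apply is_series_unique.
  - apply (is_lim_seq_ext _ (sum_n (fun n => Re (u n)))) in Hr; [exact Hr|].
    induction n.
    + now rewrite psum_0, sum_O.
    + rewrite psum_S, sum_Sn, <- IHn. reflexivity.
  - apply (is_lim_seq_ext _ (sum_n (fun n => Im (u n)))) in Hi; [exact Hi|].
    induction n.
    + now rewrite psum_0, sum_O.
    + rewrite psum_S, sum_Sn, <- IHn. reflexivity.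
Qed.

Lemma Csummable_csum (u : nat -> C) : Csummable u -> csum u (CSeries u).
Proof.
  intros [l H]. now rewrite (csum_CSeries u l H).
Qed.

Lemma csum_ext (u v : nat -> C) (l : C) :
  (forall n, u n = v n) -> csum u l -> csum v l.
Proof. intros H. now apply is_series_ext. Qed.

Lemma csum_unique (u : nat -> C) (l m : C) : csum u l -> csum u m -> l = m.
Proof. intros H K. rewrite <- (csum_CSeries _ _ H). now apply csum_CSeries. Qed.

Lemma csum_plus (u v : nat -> C) (l m : C) :
  csum u l -> csum v m -> csum (fun n => u n + v n) (l + m).
Proof. apply (is_series_plus (V := C_NormedModule)). Qed.

Lemma csum_scal (c : C) (u : nat -> C) (l : C) :
  csum u l -> csum (fun n => c * u n) (c * l).
Proof. apply (is_series_scal (V := C_NormedModule) c). Qed.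

Lemma csum_minus (u v : nat -> C) (l m : C) :
  csum u l -> csum v m -> csum (fun n => u n - v n) (l - m).
Proof. apply (is_series_minus (V := C_NormedModule)). Qed.

Lemma csum_tail (u : nat -> C) (l : C) (N : nat) :
  csum u l -> csum (fun k => u (S N + k)%nat) (l - psum u N).
Proof.
  intros H. apply (is_series_incr_n (V := C_NormedModule)); [lia|].
  simpl Nat.pred.
  replace (plus (l - psum u N) _) with l; [exact H|].
  change (l = (l - psum u N) + psum u N). ring.
Qed.

Lemma csum_term_0 (u : nat -> C) (l : C) : csum u l -> clim u 0.
Proof.
  intros H. apply csum_clim in H. apply clim_incr.
  replace (RtoC 0) with (l + -(1) * l) by ring.
  apply clim_ext with (fun n => psum u (S n) + -(1) * psum u n).
  - intros n. rewrite psum_S. ring.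
  - apply clim_plus; [now apply (proj1 (clim_incr _ _))|now apply clim_scal].
Qed.

Lemma csum_dominated (u : nat -> C) (b : nat -> R) :
  (forall n, (Cmod (u n) <= b n)%R) -> ex_series b -> exists l, csum u l.
Proof.
  intros H Hb.
  exact (ex_series_le (V := C_CompleteNormedModule) u b H Hb).
Qed.

(** The triangle inequality for infinite sums; it yields all tail estimates below. *)
Lemma csum_le (u : nat -> C) (b : nat -> R) (l : C) (B : R) :
  csum u l -> (forall n, (Cmod (u n) <= b n)%R) -> is_series b B ->
  (Cmod l <= B)%R.
Proof.
  intros H Hb HB. apply csum_clim, clim_Cmod in H.
  apply (is_lim_seq_le (fun n => Cmod (psum u n)) (sum_n b) (Cmod l) B);
    [|exact H|exact HB].
  induction n.
  - rewrite psum_0, sum_O. apply Hb.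
  - rewrite psum_S, sum_Sn. eapply Rle_trans; [apply Cmod_triangle|].
    apply Rplus_le_compat; [exact IHn|apply Hb].
Qed.

(** * Infinite q-shifted factorials *)

Lemma qpoch_add (q y : C) (n k : nat) :
  qpoch q y (n + k) = qpoch q y n * qpoch q (y * q ^ n) k.
Proof.
  induction k; simpl.
  - rewrite Nat.add_0_r. ring.
  - rewrite Nat.add_succ_r. simpl. rewrite IHk, Cpow_add_r. ring.
Qed.

Lemma qregular_shift (q y : C) (n : nat) :
  qregular q y -> qregular q (y * q ^ n).
Proof.
  intros H l. rewrite <- Cmult_assoc, <- Cpow_add_r. apply H.
Qed.

Lemma one_minus_neq0 (w : C) : w <> 1 -> 1 - w <> 0.
Proof.
  intros H E. apply H. replace w with (1 - (1 - w)) by ring. rewrite E. ring.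
Qed.

Lemma qpoch_neq0 (q y : C) (n : nat) : qregular q y -> qpoch q y n <> 0.
Proof.
  intros H. induction n; simpl.
  - apply C1_nz.
  - apply Cmult_neq_0; [exact IHn|apply one_minus_neq0, H].
Qed.

Lemma pow_lt_1 (r : R) (n : nat) : (0 <= r < 1)%R -> (0 <= r ^ n <= 1)%R.
Proof.
  intros H. induction n; simpl; [lra|]. nra.
Qed.

Lemma qregular_small (q y : C) :
  (Cmod q < 1)%R -> (Cmod y < 1)%R -> qregular q y.
Proof.
  intros Hq Hy l E.
  assert (H : Cmod (y * q ^ l) = 1%R) by now rewrite E, Cmod_1.
  rewrite Cmod_mult, Cmod_pow in H.
  assert (P := pow_lt_1 (Cmod q) l (conj (Cmod_ge_0 q) Hq)).
  assert (K := Cmod_ge_0 y). nra.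
Qed.

Lemma geom_partial (r : R) (n : nat) :
  (r < 1)%R ->
  ((1 - r ^ S n) / (1 - r) = (1 - r ^ n) / (1 - r) + r ^ n)%R.
Proof. intros H. simpl. field. lra. Qed.

(** Each factor satisfies [|1 - y q^k| <= 1 + |y| |q|^k <= exp (|y| |q|^k)], and the
    exponents form a partial geometric sum. *)
Lemma qpoch_upper (q y : C) (n : nat) :
  (Cmod q < 1)%R ->
  (Cmod (qpoch q y n) <= exp (Cmod y * ((1 - Cmod q ^ n) / (1 - Cmod q))))%R.
Proof.
  intros Hq. induction n.
  - simpl. rewrite Cmod_1, Rminus_diag. unfold Rdiv. rewrite Rmult_0_l, Rmult_0_r.
    rewrite exp_0. lra.
  - rewrite geom_partial, Rmult_plus_distr_l, exp_plus by exact Hq.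
    simpl qpoch. rewrite Cmod_mult.
    apply Rmult_le_compat; try apply Cmod_ge_0; [exact IHn|].
    eapply Rle_trans; [|apply exp_ineq1_le].
    eapply Rle_trans; [apply Cmod_triangle|].
    rewrite Cmod_opp, Cmod_1, Cmod_mult, Cmod_pow. lra.
Qed.

Lemma qpoch_bound (q y : C) :
  (Cmod q < 1)%R ->
  exists M : R, (0 < M)%R /\ forall n, (Cmod (qpoch q y n) <= M)%R.
Proof.
  intros Hq. exists (exp (Cmod y * (1 / (1 - Cmod q)))).
  split; [apply exp_pos|]. intros n.
  eapply Rle_trans; [now apply qpoch_upper|].
  assert (P := pow_lt_1 (Cmod q) n (conj (Cmod_ge_0 q) Hq)).
  destruct (Rle_lt_or_eq_dec _ _ (Rmult_le_compat_l (Cmod y)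
    ((1 - Cmod q ^ n) / (1 - Cmod q)) (1 / (1 - Cmod q)) (Cmod_ge_0 y)
    ltac:(apply Rmult_le_compat_r; [left; apply Rinv_0_lt_compat|]; lra))) as [L|L].
  - left. now apply exp_increasing.
  - right. now rewrite L.
Qed.

(** Weierstrass' inequality [|prod (1 - u_k)| >= 1 - sum |u_k|] for a small sum; it is
    what keeps an infinite product away from 0. *)
Lemma qpoch_lower (q y : C) (n : nat) :
  (Cmod q < 1)%R -> (Cmod y / (1 - Cmod q) <= 1 / 2)%R ->
  (1 - Cmod y * ((1 - Cmod q ^ n) / (1 - Cmod q)) <= Cmod (qpoch q y n))%R.
Proof.
  intros Hq Hy.
  assert (Hq0 := Cmod_ge_0 q). assert (Hy0 := Cmod_ge_0 y).
  assert (Hy1 : (Cmod y <= 1 / 2)%R).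
  { apply Rle_trans with (2 := Hy). unfold Rdiv.
    rewrite <- (Rmult_1_r (Cmod y)) at 1. apply Rmult_le_compat_l; [lra|].
    rewrite <- Rinv_1. apply Rinv_le_contravar; lra. }
  induction n.
  - simpl. rewrite Cmod_1, Rminus_diag. unfold Rdiv. lra.
  - rewrite geom_partial, Rmult_plus_distr_l by exact Hq.
    simpl qpoch. rewrite Cmod_mult.
    assert (P := pow_lt_1 (Cmod q) n (conj Hq0 Hq)).
    set (S0 := (Cmod y * ((1 - Cmod q ^ n) / (1 - Cmod q)))%R) in *.
    assert (HS : (0 <= S0 <= 1 / 2)%R).
    { assert (I : (0 < / (1 - Cmod q))%R) by (apply Rinv_0_lt_compat; lra).
      assert (E : (S0 = (Cmod y / (1 - Cmod q)) * (1 - Cmod q ^ n))%R)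
        by (unfold S0, Rdiv; ring).
      assert (0 <= Cmod y / (1 - Cmod q))%R by (apply Rmult_le_pos; lra).
      rewrite E. nra. }
    set (u := (Cmod y * Cmod q ^ n)%R).
    assert (Hu : (0 <= u <= 1 / 2)%R) by (unfold u; nra).
    assert (F : (1 - u <= Cmod (1 - y * q ^ n))%R).
    { assert (T := Cmod_triangle (1 - y * q ^ n) (y * q ^ n)).
      replace (1 - y * q ^ n + y * q ^ n) with (RtoC 1) in T by ring.
      rewrite Cmod_1, Cmod_mult, Cmod_pow in T. fold u in T. lra. }
    assert (G := Cmod_ge_0 (qpoch q y n)). nra.
Qed.

(** The consecutive differences are [- qpoch q y n * y q^n], dominated by a geometric
    sequence because the products are bounded. *)
Lemma qpoch_cvg (q y : C) :
  (Cmod q < 1)%R -> clim (qpoch q y) (qpoch_inf q y).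
Proof.
  intros Hq.
  destruct (qpoch_bound q y Hq) as [M [HM0 HM]].
  destruct (csum_dominated (fun n => qpoch q y (S n) - qpoch q y n)
    (fun n => (M * Cmod y * Cmod q ^ n)%R)) as [l Hl].
  - intros n. simpl.
    replace (qpoch q y n * (1 - y * q ^ n) - qpoch q y n)
      with (- (qpoch q y n * (y * q ^ n))) by ring.
    rewrite Cmod_opp, !Cmod_mult, Cmod_pow, Rmult_assoc.
    apply Rmult_le_compat_r; [|apply HM].
    apply Rmult_le_pos; [apply Cmod_ge_0|apply pow_le, Cmod_ge_0].
  - apply (ex_series_scal_l (K := R_AbsRing) (V := R_NormedModule)).
    apply ex_series_geom. rewrite Rabs_pos_eq by apply Cmod_ge_0. exact Hq.
  - assert (L : clim (qpoch q y) (l + 1)).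
    { apply clim_incr.
      apply clim_ext with (fun n => psum (fun n => qpoch q y (S n) - qpoch q y n) n + 1).
      - induction n.
        + rewrite psum_0. simpl. ring.
        + rewrite psum_S.
          transitivity (psum (fun n => qpoch q y (S n) - qpoch q y n) n + 1
                        + (qpoch q y (S (S n)) - qpoch q y (S n))).
          * cbv beta. ring.
          * rewrite IHn. ring.
      - apply clim_plus; [now apply csum_clim|apply clim_const]. }
    destruct (clim_proj _ _ L) as [Hr Hi].
    apply is_lim_seq_unique in Hr, Hi.
    unfold qpoch_inf. rewrite Hr, Hi. simpl.
    rewrite (surjective_pairing (l + 1)) in L. exact L.
Qed.

Lemma qpoch_inf_shift (q y : C) (n : nat) :
  (Cmod q < 1)%R ->
  qpoch_inf q y = qpoch q y n * qpoch_inf q (y * q ^ n).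
Proof.
  intros Hq. apply clim_unique with (fun k => qpoch q y (k + n)).
  - apply (proj1 (clim_incr_n _ _ _)). now apply qpoch_cvg.
  - apply clim_ext with (fun k => qpoch q y n * qpoch q (y * q ^ n) k).
    + intros k. now rewrite <- qpoch_add, Nat.add_comm.
    + apply clim_scal. now apply qpoch_cvg.
Qed.

(** After splitting off finitely many nonzero factors, y is replaced by [y q^N], so
    small that [qpoch_lower] bounds the remaining product below by 1/2. *)
Lemma qpoch_inf_neq0 (q y : C) :
  (Cmod q < 1)%R -> qregular q y -> qpoch_inf q y <> 0.
Proof.
  intros Hq Hy.
  assert (Hq0 := Cmod_ge_0 q).
  assert (L : is_lim_seq (fun n => Cmod (y * q ^ n)) 0).
  { apply is_lim_seq_ext with (fun n => (Cmod y * Cmod q ^ n)%R).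
    - intros n. now rewrite Cmod_mult, Cmod_pow.
    - replace 0%R with (Cmod y * 0)%R by ring.
      apply is_lim_seq_mult'; [apply is_lim_seq_const|].
      apply is_lim_seq_geom. now rewrite Rabs_pos_eq. }
  apply is_lim_seq_spec in L.
  assert (He : (0 < (1 - Cmod q) / 2)%R) by lra.
  (* Makes the geometric sum [|y q^N| / (1 - |q|)] at most 1/2. *)
  destruct (L (mkposreal _ He)) as [N HN].
  specialize (HN N (Nat.le_refl N)). simpl in HN.
  rewrite Rminus_0_r, Rabs_pos_eq in HN by apply Cmod_ge_0.
  rewrite (qpoch_inf_shift q y N Hq).
  apply Cmult_neq_0; [now apply qpoch_neq0|].
  apply Cmod_gt_0. apply Rlt_le_trans with (1 / 2)%R; [lra|].
  apply clim_ge with (qpoch q (y * q ^ N)); [now apply qpoch_cvg|].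
  assert (Hs : (Cmod (y * q ^ N) / (1 - Cmod q) <= 1 / 2)%R).
  { apply Rmult_le_reg_r with (1 - Cmod q)%R; [lra|].
    unfold Rdiv at 1. rewrite Rmult_assoc, Rinv_l by lra. lra. }
  intros n. eapply Rle_trans; [|now apply qpoch_lower].
  assert (P := pow_lt_1 (Cmod q) n (conj Hq0 Hq)).
  assert (K := Cmod_ge_0 (y * q ^ N)).
  assert (I : (0 < / (1 - Cmod q))%R) by (apply Rinv_0_lt_compat; lra).
  assert (Cmod (y * q ^ N) * ((1 - Cmod q ^ n) / (1 - Cmod q))
          = (Cmod (y * q ^ N) / (1 - Cmod q)) * (1 - Cmod q ^ n))%R
    by (unfold Rdiv; ring).
  assert (0 <= Cmod (y * q ^ N) / (1 - Cmod q))%R by (apply Rmult_le_pos; lra).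
  nra.
Qed.

(** * The q-binomial theorem *)

(** The coefficients of the q-binomial series. *)
Definition qbin (q A : C) (n : nat) : C := qpoch q A n / qpoch q q n.

Lemma qregular_q (q : C) : (Cmod q < 1)%R -> qregular q q.
Proof. intros H. now apply qregular_small. Qed.

Lemma qbin_0 (q A : C) : qbin q A 0 = 1.
Proof. unfold qbin. simpl. field. Qed.

Lemma qbin_S (q A : C) (n : nat) :
  (Cmod q < 1)%R ->
  qbin q A (S n) * (1 - q ^ S n) = qbin q A n * (1 - A * q ^ n).
Proof.
  intros Hq. unfold qbin. simpl.
  assert (H := qpoch_neq0 q q n (qregular_q q Hq)).
  assert (H1 := one_minus_neq0 _ (qregular_q q Hq n)).
  field. now split.
Qed.

Lemma qbin_cvg (q A : C) :
  (Cmod q < 1)%R -> clim (qbin q A) (qpoch_inf q A / qpoch_inf q q).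
Proof.
  intros Hq. assert (Hr := qregular_q q Hq).
  apply clim_mult; [now apply qpoch_cvg|].
  apply clim_inv; [now apply qpoch_inf_neq0| |now apply qpoch_cvg].
  intros n. now apply qpoch_neq0.
Qed.

Lemma qbin_bounded (q A : C) :
  (Cmod q < 1)%R ->
  exists W : R, (0 <= W)%R /\ forall n, (Cmod (qbin q A n) <= W)%R.
Proof. intros Hq. eapply clim_bounded. now apply qbin_cvg. Qed.

Lemma bounded_power_csum (w : nat -> C) (W : R) (x : C) :
  (forall n, (Cmod (w n) <= W)%R) -> (Cmod x < 1)%R ->
  exists F, csum (fun n => w n * x ^ n) F.
Proof.
  intros HW Hx.
  apply csum_dominated with (fun n => (W * Cmod x ^ n)%R).
  - intros n. rewrite Cmod_mult, Cmod_pow.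
    apply Rmult_le_compat_r; [apply pow_le, Cmod_ge_0|apply HW].
  - apply (ex_series_scal_l (K := R_AbsRing) (V := R_NormedModule)).
    apply ex_series_geom. rewrite Rabs_pos_eq by apply Cmod_ge_0. exact Hx.
Qed.

Lemma bounded_power_tail (w : nat -> C) (W : R) (x F : C) (N : nat) :
  (forall n, (Cmod (w n) <= W)%R) -> (Cmod x < 1)%R ->
  csum (fun n => w n * x ^ n) F ->
  (Cmod (F - psum (fun n => (w n * x ^ n)%C) N)
   <= W * Cmod x ^ S N * / (1 - Cmod x))%R.
Proof.
  intros HW Hx HF.
  apply csum_le with (u := fun k => w (S N + k)%nat * x ^ (S N + k))
    (b := fun k => (W * Cmod x ^ S N * Cmod x ^ k)%R).
  - now apply (csum_tail (fun n => w n * x ^ n)).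
  - intros k. rewrite Cmod_mult, Cmod_pow, pow_add, Rmult_assoc.
    apply Rmult_le_compat_r; [|apply HW].
    apply Rmult_le_pos; apply pow_le, Cmod_ge_0.
  - apply (is_series_scal_l (K := R_AbsRing) (V := R_NormedModule)).
    apply is_series_geom. rewrite Rabs_pos_eq by apply Cmod_ge_0. exact Hx.
Qed.

(** This is the recurrence [qbin_S] read on generating functions: G stands for
    [F(q x)]. *)
Lemma qbinomial_functional (q A x F G : C) :
  (Cmod q < 1)%R ->
  csum (fun n => qbin q A n * x ^ n) F ->
  csum (fun n => qbin q A n * (q * x) ^ n) G ->
  (1 - x) * F = (1 - A * x) * G.
Proof.
  intros Hq HF HG.
  (* Both sides of [F - G = x F - A x G] expand to the same power series. *)
  assert (H1 : csum (fun n => qbin q A (S n) * x ^ S n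
                             - qbin q A (S n) * (q * x) ^ S n) (F - G)).
  { assert (D := csum_tail _ _ 0 (csum_minus _ _ _ _ HF HG)).
    rewrite psum_0 in D. simpl in D.
    replace (F - G) with (F - G - (qbin q A 0 * 1 - qbin q A 0 * 1)) by ring.
    exact D. }
  assert (H2 := csum_minus _ _ _ _ (csum_scal x _ _ HF) (csum_scal (A * x) _ _ HG)).
  assert (E : F - G = x * F - A * x * G).
  { apply csum_unique with (1 := H1). eapply csum_ext, H2.
    intros n. cbv beta.
    transitivity (qbin q A (S n) * (1 - q ^ S n) * x ^ S n).
    - rewrite qbin_S, Cpow_mult_l by exact Hq. simpl. ring.
    - rewrite Cpow_mult_l. ring. }
  replace ((1 - x) * F) with ((F - G) + G - x * F) by ring. rewrite E. ring.
Qed.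

(** Iterating the functional equation gives
    [(x; q)_k F(x) = (A x; q)_k F(q^k x)], and [F(q^k x)] tends to [F(0) = 1]. *)
Lemma qbinomial_theorem (q A x : C) :
  (Cmod q < 1)%R -> (Cmod x < 1)%R ->
  csum (fun n => qbin q A n * x ^ n) (qpoch_inf q (A * x) / qpoch_inf q x).
Proof.
  intros Hq Hx. assert (Hq0 := Cmod_ge_0 q). assert (Hx0 := Cmod_ge_0 x).
  destruct (qbin_bounded q A Hq) as [W [HW0 HW]].
  assert (Hs : forall k, (Cmod (q ^ k * x) <= Cmod x)%R).
  { intros k. rewrite Cmod_mult, Cmod_pow.
    assert (P := pow_lt_1 (Cmod q) k (conj Hq0 Hq)). nra. }
  set (F := fun k => CSeries (fun n => qbin q A n * (q ^ k * x) ^ n)).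
  assert (HF : forall k, csum (fun n => qbin q A n * (q ^ k * x) ^ n) (F k)).
  { intros k.
    destruct (bounded_power_csum (qbin q A) W (q ^ k * x) HW) as [G HG].
    - eapply Rle_lt_trans; [apply Hs|exact Hx].
    - unfold F. now rewrite (csum_CSeries _ _ HG). }
  (* [F k] is the value of the q-binomial series at [q^k x]. *)
  assert (HI : forall k, qpoch q x k * F 0%nat = qpoch q (A * x) k * F k).
  { induction k.
    - simpl. ring.
    - simpl.
      replace (qpoch q x k * (1 - x * q ^ k) * F 0%nat)
        with ((1 - q ^ k * x) * (qpoch q x k * F 0%nat)) by ring.
      rewrite IHk.
      replace ((1 - q ^ k * x) * (qpoch q (A * x) k * F k))
        with (qpoch q (A * x) k * ((1 - q ^ k * x) * F k)) by ring.
      rewrite (qbinomial_functional q A (q ^ k * x) (F k) (F (S k)) Hq (HF k)).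
      + ring.
      + eapply csum_ext, (HF (S k)). intros n. cbv beta.
        do 2 f_equal. simpl. ring. }
  assert (HL : clim F 1).
  { unfold clim.
    apply squeeze_0 with (fun k => (W * Cmod x / (1 - Cmod x) * Cmod q ^ k)%R).
    - intros k. split; [apply Cmod_ge_0|].
      assert (T := bounded_power_tail _ W _ _ 0 HW
                     (Rle_lt_trans _ _ _ (Hs k) Hx) (HF k)).
      rewrite psum_0, qbin_0 in T. simpl in T. rewrite Rmult_1_r, !Cmult_1_r in T.
      eapply Rle_trans; [exact T|].
      assert (E : Cmod (q ^ k * x) = (Cmod q ^ k * Cmod x)%R)
        by now rewrite Cmod_mult, Cmod_pow.
      rewrite E at 1.
      replace (W * Cmod x / (1 - Cmod x) * Cmod q ^ k)%R
        with (W * (Cmod q ^ k * Cmod x) * / (1 - Cmod x))%R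
        by (unfold Rdiv; ring).
      assert (P := pow_lt_1 (Cmod q) k (conj Hq0 Hq)).
      apply Rmult_le_compat_l; [apply Rmult_le_pos; [lra|nra]|].
      assert (K := Hs k). apply Rinv_le_contravar; lra.
    - replace 0%R with (W * Cmod x / (1 - Cmod x) * 0)%R by ring.
      apply is_lim_seq_mult'; [apply is_lim_seq_const|].
      apply is_lim_seq_geom. now rewrite Rabs_pos_eq. }
  assert (E : qpoch_inf q x * F 0%nat = qpoch_inf q (A * x) * 1).
  { apply clim_unique with (fun k => qpoch q x k * F 0%nat).
    - apply clim_mult; [now apply qpoch_cvg|apply clim_const].
    - eapply clim_ext; [intros k; symmetry; apply HI|].
      apply clim_mult; [now apply qpoch_cvg|exact HL]. }
  assert (Hn := qpoch_inf_neq0 q x Hq (qregular_small q x Hq Hx)).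
  replace (qpoch_inf q (A * x) / qpoch_inf q x) with (F 0%nat).
  - eapply csum_ext, (HF 0%nat). intros n. cbv beta. simpl. now rewrite Cmult_1_l.
  - replace (F 0%nat) with ((qpoch_inf q x * F 0%nat) / qpoch_inf q x)
      by (field; exact Hn).
    rewrite E. field. exact Hn.
Qed.

(** * Interchanging the two summations *)

(** The number [y q^l] is the ratio of the inner series over n that goes with the l-th
    coefficient.  Only the support of d matters: the condition is compatible with
    [|y| >= 1], and the common bound rho makes the inner tails uniformly small in l. *)
Definition ratios_below_one (q y : C) (d : nat -> C) : Prop :=
  exists rho : R, (0 <= rho < 1)%R /\
    forall l, d l <> 0 -> (Cmod (y * q ^ l) <= rho)%R.

Lemma csum_terms_bounded (u : nat -> C) (l : C) :
  csum u l -> exists M : R, (0 <= M)%R /\ forall n, (Cmod (u n) <= M)%R.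
Proof. intros H. exact (clim_bounded u 0 (csum_term_0 u l H)). Qed.

Lemma Cpow_swap (c : C) (n m : nat) : (c ^ n) ^ m = (c ^ m) ^ n.
Proof. now rewrite <- !Cpow_mult_r, Nat.mul_comm. Qed.

(** For j = 0 this is the possibly conditional convergence that is assumed; for j > 0
    the terms are bounded times a geometric sequence. *)
Lemma csum_rescaled (q : C) (d : nat -> C) (j : nat) :
  (Cmod q < 1)%R -> Csummable d -> exists S, csum (fun l => d l * (q ^ j) ^ l) S.
Proof.
  intros Hq [S HS]. destruct j.
  - exists S. eapply csum_ext, HS. intros l. simpl. rewrite Cpow_1_l. ring.
  - destruct (csum_terms_bounded d S HS) as [M [_ HM]].
    apply bounded_power_csum with M; [exact HM|].
    rewrite Cmod_pow. simpl.
    assert (P := pow_lt_1 (Cmod q) j (conj (Cmod_ge_0 q) Hq)).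
    assert (Q := Cmod_ge_0 q). nra.
Qed.

Lemma psum_first_nonzero (u : nat -> C) (N : nat) :
  (forall l, (l < N)%nat -> u l = 0) -> psum u N = u N.
Proof.
  destruct N; intros H; [apply psum_0|].
  rewrite psum_S.
  enough (E : forall k, (k <= N)%nat -> psum u k = 0) by (rewrite E; [ring|lia]).
  induction k; intros Hk.
  - rewrite psum_0. apply H. lia.
  - rewrite psum_S, IHk, H by lia. ring.
Qed.

(** A power series is asymptotic to its first nonzero term at the origin, here along
    the points [q^n]. *)
Lemma leading_behaviour (q : C) (d : nat -> C) (phi : nat -> C) (N : nat) :
  (0 < Cmod q < 1)%R ->
  (forall n, csum (fun l => d l * (q ^ n) ^ l) (phi n)) ->
  (forall l, (l < N)%nat -> d l = 0) ->
  clim (fun n => phi n / (q ^ n) ^ N) (d N).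
Proof.
  intros Hq Hphi Hd.
  assert (Hd0 : csum d (phi 0%nat)).
  { eapply csum_ext, (Hphi 0%nat). intros l. simpl. rewrite Cpow_1_l. ring. }
  destruct (csum_terms_bounded _ _ Hd0) as [M [HM0 HM]].
  assert (Hqn : forall n, q ^ n <> 0).
  { intros n. apply Cpow_nz. apply Cmod_gt_0. lra. }
  (* The tail bound needs [|q^n| < 1], so n = 0 is skipped. *)
  apply clim_incr. unfold clim.
  apply squeeze_0 with (fun n => (M * / (1 - Cmod q) * Cmod q ^ S n)%R).
  - intros n. split; [apply Cmod_ge_0|].
    set (x := q ^ S n).
    assert (Ex : Cmod x = (Cmod q ^ S n)%R) by (unfold x; now rewrite Cmod_pow).
    assert (Hx : (Cmod x <= Cmod q)%R).
    { rewrite Ex. simpl.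
      assert (P := pow_lt_1 (Cmod q) n ltac:(lra)). nra. }
    assert (Hxn : x ^ N <> 0) by (apply Cpow_nz, Hqn).
    assert (T := bounded_power_tail d M x _ N HM ltac:(lra) (Hphi (S n))).
    rewrite psum_first_nonzero in T
      by (intros l Hl; rewrite Hd by exact Hl; ring).
    replace (phi (S n) / x ^ N - d N)
      with ((phi (S n) - d N * x ^ N) / x ^ N) by (field; exact Hxn).
    rewrite Cmod_div, Cmod_pow by exact Hxn.
    assert (Hp : (0 < Cmod x ^ N)%R) by (apply pow_lt, Cmod_gt_0, Hqn).
    apply Rmult_le_reg_r with (Cmod x ^ N)%R; [exact Hp|].
    unfold Rdiv. rewrite Rmult_assoc, Rinv_l, Rmult_1_r by lra.
    eapply Rle_trans; [exact T|]. rewrite <- Ex.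
    replace (M * / (1 - Cmod q) * Cmod x * Cmod x ^ N)%R
      with (M * Cmod x ^ S N * / (1 - Cmod q))%R by (simpl; ring).
    apply Rmult_le_compat_l.
    + apply Rmult_le_pos; [exact HM0|]. apply pow_le, Cmod_ge_0.
    + apply Rinv_le_contravar; lra.
  - replace 0%R with (M * / (1 - Cmod q) * 0)%R by ring.
    apply is_lim_seq_mult'; [apply is_lim_seq_const|].
    apply (proj1 (is_lim_seq_incr_1 (fun n => (Cmod q ^ n)%R) 0)).
    apply is_lim_seq_geom. rewrite Rabs_pos_eq; lra.
Qed.

Lemma first_nonzero (d : nat -> C) :
  (forall l, d l = 0) \/
  exists N, d N <> 0 /\ forall l, (l < N)%nat -> d l = 0.
Proof.
  destruct (classic (forall l, d l = 0)) as [H|H]; [now left|right].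
  apply not_all_ex_not in H. destruct H as [n Hn].
  destruct (dec_inh_nat_subset_has_unique_least_element (fun l => d l <> 0)
    (fun l => classic _) (ex_intro _ n Hn)) as [N [[HN Hmin] _]].
  exists N. split; [exact HN|]. intros l Hl. apply NNPP. intros K.
  specialize (Hmin l K). lia.
Qed.

(** With N the first index where d is nonzero, the terms behave like a nonzero constant
    times [(y q^N)^n]; they can vanish in the limit only if [|y q^N| < 1], and the
    ratios of later indices are smaller still. *)
Lemma ratios_below_one_of_vanishing_terms (q A y : C) (d phi : nat -> C) :
  (0 < Cmod q < 1)%R -> qregular q A ->
  (forall n, csum (fun l => d l * (q ^ n) ^ l) (phi n)) ->
  clim (fun n => qbin q A n * y ^ n * phi n) 0 ->
  ratios_below_one q y d.
Proof.
  intros Hq HA Hphi H.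
  destruct (first_nonzero d) as [Hd|[N [HN Hd]]].
  { exists 0%R. split; [lra|]. intros l Hl. now elim Hl. }
  assert (Hlim := clim_mult _ _ _ _ (qbin_cvg q A (proj2 Hq))
                    (leading_behaviour q d phi N Hq Hphi Hd)).
  assert (HL : qpoch_inf q A / qpoch_inf q q * d N <> 0).
  { assert (Q := qpoch_inf_neq0 q q (proj2 Hq) (qregular_q q (proj2 Hq))).
    apply Cmult_neq_0; [|exact HN]. apply Cmult_neq_0.
    - now apply qpoch_inf_neq0.
    - apply Cmod_gt_0. rewrite Cmod_inv by exact Q.
      apply Rinv_0_lt_compat. now apply Cmod_gt_0. }
  assert (Hy : (Cmod (y * q ^ N) < 1)%R).
  { apply Rnot_le_lt. intros Hy. apply Cmod_gt_0 in HL.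
    apply clim_Cmod in Hlim. apply clim_Cmod in H. rewrite Cmod_0 in H.
    assert (HH := fun K => is_lim_seq_le _ _ _ _ K Hlim H). simpl in HH.
    apply (Rlt_not_le _ _ HL). apply HH. intros n.
    assert (Hqn : (q ^ n) ^ N <> 0) by (do 2 apply Cpow_nz; apply Cmod_gt_0; lra).
    replace (qbin q A n * y ^ n * phi n)
      with ((y * q ^ N) ^ n * (qbin q A n * (phi n / (q ^ n) ^ N))).
    - rewrite (Cmod_mult ((y * q ^ N) ^ n)), Cmod_pow.
      assert (P := pow_R1_Rle _ n Hy).
      assert (K := Cmod_ge_0 (qbin q A n * (phi n / (q ^ n) ^ N))). nra.
    - rewrite Cpow_mult_l, (Cpow_swap q N n). field. exact Hqn. }
  exists (Cmod (y * q ^ N)). split; [split; [apply Cmod_ge_0|exact Hy]|].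
  intros l Hl.
  assert (HNl : (N <= l)%nat).
  { apply Nat.nlt_ge. intros K. now apply Hl, Hd. }
  replace l with (N + (l - N))%nat by lia.
  rewrite Cpow_add_r, Cmult_assoc, Cmod_mult, (Cmod_pow q (l - N)).
  assert (P := pow_lt_1 (Cmod q) (l - N) ltac:(lra)).
  assert (K := Cmod_ge_0 (y * q ^ N)). nra.
Qed.

(** Truncating at n <= N commutes with the sum over l.  The error committed in the
    l-th inner series is at most a constant times [rho^N |q|^l]: one factor [y q^l] of
    the tail provides the summability over l, the other N provide the decay in N. *)
Lemma summation_interchange (q A y : C) (d phi : nat -> C) :
  (Cmod q < 1)%R -> ratios_below_one q y d ->
  (forall n, csum (fun l => d l * (q ^ n) ^ l) (phi n)) ->
  exists T : C,
    csum (fun l => d l * (qpoch_inf q (A * (y * q ^ l)) / qpoch_inf q (y * q ^ l))) T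
    /\ csum (fun n => qbin q A n * y ^ n * phi n) T.
Proof.
  intros Hq [rho [Hrho Hdec]] Hphi. assert (Hq0 := Cmod_ge_0 q).
  set (S0 := fun l => qpoch_inf q (A * (y * q ^ l)) / qpoch_inf q (y * q ^ l)).
  set (P := fun l => psum (fun n => qbin q A n * (y * q ^ l) ^ n)).
  assert (Hd0 : csum d (phi 0%nat)).
  { eapply csum_ext, (Hphi 0%nat). intros l. simpl. rewrite Cpow_1_l. ring. }
  destruct (csum_terms_bounded _ _ Hd0) as [M [HM0 HM]].
  destruct (qbin_bounded q A Hq) as [W [HW0 HW]].
  (* M bounds the [d_l], W bounds the q-binomial coefficients. *)
  set (K := (M * (W * Cmod y) * / (1 - rho))%R).
  assert (Hinv : (0 < / (1 - rho))%R) by (apply Rinv_0_lt_compat; lra).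
  assert (HK : (0 <= K)%R).
  { assert (Y := Cmod_ge_0 y). unfold K. apply Rmult_le_pos; [|lra].
    apply Rmult_le_pos; [lra|]. now apply Rmult_le_pos. }
  assert (Hgeom : ex_series (fun l => (Cmod q ^ l)%R)).
  { apply ex_series_geom. now rewrite Rabs_pos_eq. }
  assert (Htail : forall N l,
    (Cmod (d l * (S0 l - P l N)) <= K * rho ^ N * Cmod q ^ l)%R).
  { intros N l. destruct (classic (d l = 0)) as [E|E].
    - rewrite E, Cmult_0_l, Cmod_0.
      apply Rmult_le_pos; [apply Rmult_le_pos; [exact HK|]|]; apply pow_le; lra.
    - specialize (Hdec l E). set (x := y * q ^ l) in *.
      assert (X := Cmod_ge_0 x).
      assert (T := bounded_power_tail (qbin q A) W x _ N HW ltac:(lra)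
                     (qbinomial_theorem q A x Hq ltac:(lra))).
      rewrite Cmod_mult.
      apply Rle_trans with (M * (W * Cmod x ^ S N * / (1 - Cmod x)))%R.
      + apply Rmult_le_compat; try apply Cmod_ge_0; [apply HM|exact T].
      + replace (K * rho ^ N * Cmod q ^ l)%R
          with (M * (W * (Cmod x * rho ^ N) * / (1 - rho)))%R
          by (unfold K, x; rewrite Cmod_mult, Cmod_pow; ring).
        apply Rmult_le_compat_l; [exact HM0|].
        apply Rmult_le_compat.
        * apply Rmult_le_pos; [lra|]. now apply pow_le.
        * left. apply Rinv_0_lt_compat. lra.
        * apply Rmult_le_compat_l; [lra|]. simpl.
          apply Rmult_le_compat_l; [lra|]. apply pow_incr. lra.
        * apply Rinv_le_contravar; lra. }
  assert (Hfin : forall N, csum (fun l => d l * P l N)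
                             (psum (fun n => qbin q A n * y ^ n * phi n) N)).
  { induction N.
    - rewrite psum_0.
      apply csum_ext with (fun l => (qbin q A 0 * y ^ 0) * (d l * (q ^ 0) ^ l)).
      + intros l. unfold P. rewrite psum_0. simpl. rewrite Cpow_1_l. ring.
      + apply csum_scal, Hphi.
    - rewrite psum_S.
      apply csum_ext with (fun l => d l * P l N
        + (qbin q A (S N) * y ^ S N) * (d l * (q ^ S N) ^ l)).
      + intros l. unfold P. rewrite psum_S, Cpow_mult_l, (Cpow_swap q l (S N)). ring.
      + apply csum_plus; [exact IHN|]. apply csum_scal, Hphi. }
  (* Splitting off n = 0 isolates the possibly conditionally convergent part. *)
  assert (HT : exists T, csum (fun l => d l * S0 l) T).
  { destruct (csum_dominated (fun l => d l * (S0 l - P l 0%nat))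
                (fun l => (K * rho ^ 0 * Cmod q ^ l)%R) (Htail 0%nat)) as [T HT].
    - now apply (ex_series_scal_l (K := R_AbsRing) (V := R_NormedModule)).
    - eexists. eapply csum_ext, (csum_plus _ _ _ _ HT (Hfin 0%nat)).
      intros l. cbv beta. ring. }
  destruct HT as [T HT]. exists T. split; [exact HT|].
  apply csum_clim. unfold clim.
  apply squeeze_0 with (fun N => (K * Series (fun l => (Cmod q ^ l)%R) * rho ^ N)%R).
  - intros N. split; [apply Cmod_ge_0|].
    rewrite <- Cmod_opp.
    apply csum_le with (u := fun l => d l * (S0 l - P l N))
                       (b := fun l => (K * rho ^ N * Cmod q ^ l)%R).
    + replace (- (psum (fun n => qbin q A n * y ^ n * phi n) N - T))
        with (T - psum (fun n => qbin q A n * y ^ n * phi n) N) by ring.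
      eapply csum_ext, (csum_minus _ _ _ _ HT (Hfin N)).
      intros l. cbv beta. ring.
    + apply Htail.
    + replace (K * Series (fun l => (Cmod q ^ l)%R) * rho ^ N)%R
        with (K * rho ^ N * Series (fun l => (Cmod q ^ l)%R))%R by ring.
      apply (is_series_scal_l (K := R_AbsRing) (V := R_NormedModule)).
      now apply Series_correct.
  - replace 0%R with (K * Series (fun l => (Cmod q ^ l)%R) * 0)%R by ring.
    apply is_lim_seq_mult'; [apply is_lim_seq_const|].
    apply is_lim_seq_geom. rewrite Rabs_pos_eq; lra.
Qed.

(** * Powers along a logarithm branch *)

Lemma Cexp_plus (v w : C) : Cexp (v + w) = Cexp v * Cexp w.
Proof.
  destruct v as [a b], w as [c d]. unfold Cexp, Cmult, Cplus, Re, Im. simpl.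
  rewrite exp_plus, cos_plus, sin_plus. f_equal; ring.
Qed.

Lemma Cexp_0 : Cexp 0 = 1.
Proof. unfold Cexp. simpl. rewrite exp_0, cos_0, sin_0. unfold RtoC. f_equal; ring. Qed.

Lemma Cexp_neq0 (w : C) : Cexp w <> 0.
Proof.
  intros E. apply C1_nz. rewrite <- Cexp_0.
  replace (RtoC 0) with (w + - w) by ring. rewrite Cexp_plus, E. ring.
Qed.

Lemma Cexp_nat (n : nat) (w : C) : Cexp (RtoC (INR n) * w) = Cexp w ^ n.
Proof.
  induction n.
  - simpl. rewrite Cmult_0_l. apply Cexp_0.
  - rewrite S_INR, RtoC_plus, Cpow_S, <- IHn, <- Cexp_plus. f_equal. ring.
Qed.

Lemma cpow_plus (Lg : C -> C) (w u v : C) : cpow Lg w (u + v) = cpow Lg w u * cpow Lg w v.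
Proof. unfold cpow. rewrite <- Cexp_plus. f_equal. ring. Qed.

Lemma cpow_neq0 (Lg : C -> C) (w u : C) : cpow Lg w u <> 0.
Proof. apply Cexp_neq0. Qed.

Lemma cpow_0 (Lg : C -> C) (w : C) : cpow Lg w 0 = 1.
Proof. unfold cpow. rewrite Cmult_0_l. apply Cexp_0. Qed.

Lemma cpow_opp (Lg : C -> C) (w u : C) : cpow Lg w (- u) = / cpow Lg w u.
Proof.
  assert (H := cpow_neq0 Lg w u).
  assert (E : cpow Lg w u * cpow Lg w (- u) = 1).
  { rewrite <- cpow_plus, <- (cpow_0 Lg w). f_equal. ring. }
  replace (cpow Lg w (- u)) with (cpow Lg w u * cpow Lg w (- u) / cpow Lg w u)
    by (field; exact H).
  rewrite E. field. exact H.
Qed.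

Lemma cpow_1 (Lg : C -> C) (HLg : forall t : C, t <> 0 -> Cexp (Lg t) = t) (w : C) :
  w <> 0 -> cpow Lg w 1 = w.
Proof. intros H. unfold cpow. rewrite Cmult_1_l. now apply HLg. Qed.

Lemma cpow_nat (Lg : C -> C) (HLg : forall t : C, t <> 0 -> Cexp (Lg t) = t)
    (w : C) (n : nat) :
  w <> 0 -> cpow Lg w (RtoC (INR n)) = w ^ n.
Proof. intros H. unfold cpow. rewrite Cexp_nat. now rewrite HLg. Qed.

(** The derivative needs the Kober integral at every lattice point, not only at z. *)
Lemma log_branch_shift (Lg : C -> C) (q z : C) (j : nat) :
  log_branch Lg q z -> log_branch Lg q (z * q ^ j).
Proof.
  intros [H1 H2]. split; [exact H1|]. intros n.
  rewrite <- Cmult_assoc, <- Cpow_add_r, !H2, plus_INR, RtoC_plus. ring.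
Qed.

Lemma cpow_lattice (Lg : C -> C) (q x nu : C) (n : nat) :
  log_branch Lg q x ->
  cpow Lg (x * q ^ n) nu = cpow Lg x nu * cpow Lg q nu ^ n.
Proof.
  intros [_ H]. unfold cpow. rewrite H, <- Cexp_nat, <- Cexp_plus. f_equal. ring.
Qed.

(** * The Kober integral of a power series *)

Lemma unit_disc_neq (q : C) : (0 < Cmod q < 1)%R -> q <> 0 /\ 1 - q <> 0.
Proof.
  intros Hq. split.
  - apply Cmod_gt_0. lra.
  - apply one_minus_neq0. intros E. rewrite E, Cmod_1 in Hq. lra.
Qed.

(** The part of the Kober integrand that does not depend on the lattice point. *)
Definition kober_scale (Lg : C -> C) (q nu mu x : C) : C :=
  qpoch_inf q q / qpoch_inf q (cpow Lg q mu) * cpow Lg x nu.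

Lemma Cinv_neq0 (w : C) : w <> 0 -> / w <> 0.
Proof.
  intros H. apply Cmod_gt_0. rewrite Cmod_inv by exact H.
  apply Rinv_0_lt_compat. now apply Cmod_gt_0.
Qed.

Lemma kober_scale_neq0 (Lg : C -> C) (q nu mu x : C) :
  (Cmod q < 1)%R -> qregular q (cpow Lg q mu) -> kober_scale Lg q nu mu x <> 0.
Proof.
  intros Hq Hmu. apply Cmult_neq_0; [|apply cpow_neq0].
  apply Cmult_neq_0; [|apply Cinv_neq0]; apply qpoch_inf_neq0; auto.
  now apply qregular_q.
Qed.

(** At [t = x q^n] the kernel is [(q q^n; q)_oo / (q^mu q^n; q)_oo]; shifting both
    infinite products back to n = 0 leaves the q-binomial coefficient of [q^mu]. *)
Lemma kober_integrand_lattice (Lg : C -> C) (q nu mu : C) (f : C -> C) (x : C) (n : nat) :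
  (0 < Cmod q < 1)%R -> x <> 0 -> log_branch Lg q x ->
  qregular q (cpow Lg q mu) ->
  q ^ n * kober_integrand Lg q nu mu f x (x * q ^ n) =
  kober_scale Lg q nu mu x *
    (qbin q (cpow Lg q mu) n * cpow Lg q (nu + 1) ^ n * f (x * q ^ n)).
Proof.
  intros Hq Hx HL Hmu. destruct (unit_disc_neq q Hq) as [Hq0 _].
  destruct Hq as [_ Hq].
  unfold kober_integrand, qpoch_cplx, kober_scale, qbin.
  rewrite (cpow_lattice Lg q x nu n HL).
  replace (x * q ^ n * q / x) with (q * q ^ n) by (field; exact Hx).
  assert (E : q * q ^ n * cpow Lg q (mu - 1) = cpow Lg q mu * q ^ n).
  { replace (cpow Lg q mu) with (cpow Lg q (mu - 1) * q); [ring|].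
    rewrite <- (cpow_1 Lg (proj1 HL) q Hq0) at 2. rewrite <- cpow_plus.
    f_equal. ring. }
  rewrite E, cpow_plus, (cpow_1 Lg (proj1 HL) q Hq0), Cpow_mult_l.
  assert (Hr := qregular_q q Hq).
  rewrite (qpoch_inf_shift q q n Hq), (qpoch_inf_shift q (cpow Lg q mu) n Hq).
  assert (N1 := qpoch_neq0 q q n Hr).
  assert (N2 := qpoch_neq0 q _ n Hmu).
  assert (N3 := qpoch_inf_neq0 q _ Hq (qregular_shift q _ n Hmu)).
  field. now repeat split.
Qed.

Lemma ratios_below_one_of_integrable (Lg : C -> C) (q nu mu : C) (f : C -> C) (x : C)
    (d : nat -> C) :
  (0 < Cmod q < 1)%R -> x <> 0 -> log_branch Lg q x ->
  qregular q (cpow Lg q mu) ->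
  (forall n, csum (fun l => d l * (q ^ n) ^ l) (f (x * q ^ n))) ->
  jackson_integrable q (kober_integrand Lg q nu mu f x) x ->
  ratios_below_one q (cpow Lg q (nu + 1)) d.
Proof.
  intros Hq Hx HL Hmu Hf HJ.
  apply ratios_below_one_of_vanishing_terms with (A := cpow Lg q mu)
    (phi := fun n => f (x * q ^ n)); auto.
  assert (HK := kober_scale_neq0 Lg q nu mu x (proj2 Hq) Hmu).
  apply Csummable_csum, csum_term_0, (clim_scal (/ kober_scale Lg q nu mu x)) in HJ.
  rewrite Cmult_0_r in HJ. eapply clim_ext, HJ.
  intros n. cbv beta. rewrite kober_integrand_lattice by assumption.
  field. exact HK.
Qed.

(** In the summed q-binomial series, [(y' q^l; q)_oo / (y q^l; q)_oo] with
    [y = q^(nu+1)] and [y' = q^mu y] is [(y'; q)_oo / (y; q)_oo] times the ratio of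
    finite products in the conclusion. *)
Lemma kober_integral_power_series (Lg : C -> C) (q nu mu : C) (f : C -> C) (x : C)
    (d : nat -> C) :
  (0 < Cmod q < 1)%R -> x <> 0 -> log_branch Lg q x ->
  qregular q (cpow Lg q mu) ->
  qregular q (cpow Lg q (nu + 1)) -> qregular q (cpow Lg q (nu + mu + 1)) ->
  (forall n, csum (fun l => d l * (q ^ n) ^ l) (f (x * q ^ n))) ->
  ratios_below_one q (cpow Lg q (nu + 1)) d ->
  exists T : C,
    csum (fun l => d l * (qpoch q (cpow Lg q (nu + 1)) l
                          / qpoch q (cpow Lg q (nu + mu + 1)) l)) T
    /\ kober_integral Lg q nu mu f x
       = qGamma Lg q (nu + 1) / qGamma Lg q (nu + mu + 1) * T.
Proof.
  intros Hq Hx HL Hmu Hnu Hnumu Hf Hd.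
  destruct (unit_disc_neq q Hq) as [Hq0 Hq1].
  destruct (summation_interchange q (cpow Lg q mu) (cpow Lg q (nu + 1)) d
    (fun n => f (x * q ^ n)) (proj2 Hq) Hd Hf) as [T [HT HJ]].
  assert (EJ : jackson q (kober_integrand Lg q nu mu f x) x
               = (1 - q) * x * (kober_scale Lg q nu mu x * T)).
  { unfold jackson. f_equal. apply csum_CSeries.
    eapply csum_ext, (csum_scal _ _ _ HJ). intros n. cbv beta.
    now rewrite kober_integrand_lattice. }
  destruct Hq as [_ Hq].
  set (y := cpow Lg q (nu + 1)) in *. set (y' := cpow Lg q (nu + mu + 1)) in *.
  assert (Ey : cpow Lg q mu * y = y').
  { unfold y, y'. rewrite <- cpow_plus. f_equal. ring. }
  assert (N1 := qpoch_inf_neq0 q y Hq Hnu).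
  assert (N2 := qpoch_inf_neq0 q y' Hq Hnumu).
  assert (N3 := qpoch_inf_neq0 q _ Hq Hmu).
  assert (N4 := qpoch_inf_neq0 q q Hq (qregular_q q Hq)).
  exists (qpoch_inf q y / qpoch_inf q y' * T). split.
  - eapply csum_ext, (csum_scal (qpoch_inf q y / qpoch_inf q y') _ _ HT).
    intros l. cbv beta. rewrite (Cmult_assoc (cpow Lg q mu)), Ey.
    rewrite (qpoch_inf_shift q y l Hq), (qpoch_inf_shift q y' l Hq).
    assert (M1 := qpoch_neq0 q y' l Hnumu).
    assert (M2 := qpoch_inf_neq0 q _ Hq (qregular_shift q y l Hnu)).
    assert (M3 := qpoch_inf_neq0 q _ Hq (qregular_shift q y' l Hnumu)).
    field. now repeat split.
  - unfold kober_integral. rewrite EJ. unfold qGamma, kober_scale.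
    fold y y'.
    assert (P := cpow_neq0 Lg (1 - q)).
    assert (X := cpow_neq0 Lg x nu).
    replace (- nu - 1) with (- nu + - (1)) by ring.
    rewrite (cpow_plus Lg x), !cpow_opp, (cpow_1 Lg (proj1 HL) x Hx).
    replace (1 - mu) with (1 + - mu) by ring.
    replace (1 - (nu + 1)) with (- nu) by ring.
    replace (1 - (nu + mu + 1)) with (- nu + - mu) by ring.
    rewrite !(cpow_plus Lg (1 - q)), !(cpow_opp Lg (1 - q)),
      (cpow_1 Lg (proj1 HL) (1 - q) Hq1).
    field. repeat split; auto.
Qed.

(** * The Kober derivative of a power series *)

(** The q-number [ [nu+i] ] and the q-derivative share the denominator [1 - q], and the
    terms [q^(nu+i) g(x)] cancel. *)
Lemma kober_factor_shift (Lg : C -> C) (q nu : C) (i : nat) (g : C -> C) (x : C) :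
  (0 < Cmod q < 1)%R -> x <> 0 ->
  kober_factor Lg q nu i g x
  = (g x - cpow Lg q (nu + RtoC (INR i)) * g (q * x)) / (1 - q).
Proof.
  intros Hq Hx. destruct (unit_disc_neq q Hq) as [Hq0 Hq1].
  unfold kober_factor, qnum, qderiv. field. now split.
Qed.

(** Each factor is diagonal on monomials, by [kober_factor_shift]; the product of the
    m eigenvalues [(1 - q^(nu+i+l)) / (1 - q)] is a q-shifted factorial.  All lattice
    points are treated together because a factor at [z q^j] uses [z q^(j+1)]. *)
Lemma kober_factors_power_series (Lg : C -> C) (q nu z : C) (m : nat) :
  (0 < Cmod q < 1)%R -> z <> 0 -> log_branch Lg q z ->
  forall (e : nat -> C) (g : C -> C),
  (forall j, csum (fun l => e l * (q ^ j) ^ l) (g (z * q ^ j))) ->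
  forall j, csum (fun l => e l * qpoch q (cpow Lg q (nu + 1) * q ^ l) m
                           / (1 - q) ^ m * (q ^ j) ^ l)
                 (kober_factors Lg q nu m g (z * q ^ j)).
Proof.
  intros Hq Hz HL. destruct (unit_disc_neq q Hq) as [Hq0 Hq1].
  induction m as [|k IH]; intros e g Hg j.
  - eapply csum_ext, Hg. intros l. simpl. field.
  - simpl kober_factors.
    set (y := cpow Lg q (nu + 1)).
    assert (Hy : cpow Lg q (nu + RtoC (INR (S k))) = y * q ^ k).
    { unfold y. rewrite <- (cpow_nat Lg (proj1 HL) q k Hq0), <- cpow_plus.
      f_equal. rewrite S_INR, RtoC_plus. ring. }
    assert (Hn : (1 - q) ^ k <> 0) by now apply Cpow_nz.
    enough (He : forall i, csum
      (fun l => e l * (1 - y * q ^ k * q ^ l) / (1 - q) * (q ^ i) ^ l)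
      (kober_factor Lg q nu (S k) g (z * q ^ i))).
    { eapply csum_ext, (IH _ _ He j).
      intros l. cbv beta. fold y. simpl. field. now split. }
    intros i. rewrite kober_factor_shift, Hy; [|exact Hq|].
    2:{ apply Cmult_neq_0; [exact Hz|now apply Cpow_nz]. }
    replace (q * (z * q ^ i)) with (z * q ^ S i) by (simpl; ring).
    replace ((g (z * q ^ i) - y * q ^ k * g (z * q ^ S i)) / (1 - q))
      with (/ (1 - q) * (g (z * q ^ i) - y * q ^ k * g (z * q ^ S i)))
      by (field; exact Hq1).
    eapply csum_ext, (csum_scal _ _ _ (csum_minus _ _ _ _ (Hg i)
      (csum_scal (y * q ^ k) _ _ (Hg (S i))))).
    intros l. cbv beta. rewrite (Cpow_swap q (S i) l).
    rewrite Cpow_S, (Cpow_swap q l i). field. exact Hq1.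
Qed.

(** * The basic function R and its Kober transforms *)

Lemma qR_term_scaled (Lg : C -> C) (q : C) (a b : list C) (alpha beta z w : C) (l : nat) :
  qR_term Lg q a b alpha beta (z * w) l = qR_term Lg q a b alpha beta z l * w ^ l.
Proof. unfold qR_term. cbv zeta. rewrite Cpow_mult_l. unfold Cdiv. ring. Qed.

Lemma qpoch_list_snoc (q : C) (cs : list C) (c : C) (l : nat) :
  qpoch_list q (cs ++ c :: nil) l = qpoch_list q cs l * qpoch q c l.
Proof.
  induction cs as [|c0 cs IH]; simpl; [|rewrite IH]; ring.
Qed.

Lemma qpoch_list_neq0 (q : C) (cs : list C) (l : nat) :
  List.Forall (qregular q) cs -> qpoch_list q cs l <> 0.
Proof.
  induction 1; simpl; [apply C1_nz|].
  apply Cmult_neq_0; [now apply qpoch_neq0|assumption].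
Qed.

Lemma qR_term_snoc (Lg : C -> C) (q : C) (a b : list C) (c c' alpha beta z : C) (l : nat) :
  List.Forall (qregular q) b -> qregular q c' ->
  qR_term Lg q (a ++ c :: nil) (b ++ c' :: nil) alpha beta z l
  = qR_term Lg q a b alpha beta z l * (qpoch q c l / qpoch q c' l).
Proof.
  intros Hb Hc. unfold qR_term. cbv zeta.
  replace (1 + Z.of_nat (length (b ++ c' :: nil)) - Z.of_nat (length (a ++ c :: nil)))%Z
    with (1 + Z.of_nat (length b) - Z.of_nat (length a))%Z
    by (rewrite !length_app; cbn [length]; lia).
  rewrite !qpoch_list_snoc.
  assert (H1 := qpoch_list_neq0 q b l Hb).
  assert (H2 := qpoch_neq0 q c' l Hc).
  set (w := _ / (qpoch q q l * _)). field. now split.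
Qed.

Lemma qR_on_lattice (Lg : C -> C) (q : C) (a b : list C) (alpha beta z : C) (n : nat) :
  (Cmod q < 1)%R -> Csummable (qR_term Lg q a b alpha beta z) ->
  csum (fun l => qR_term Lg q a b alpha beta z l * (q ^ n) ^ l)
       (qR Lg q a b alpha beta (z * q ^ n)).
Proof.
  intros Hq H.
  destruct (csum_rescaled q _ n Hq H) as [S HS].
  unfold qR. rewrite (csum_CSeries _ S); [exact HS|].
  eapply csum_ext, HS. intros l. symmetry. apply qR_term_scaled.
Qed.

Lemma ratios_rescaled (q y : C) (d : nat -> C) (j : nat) :
  ratios_below_one q y d -> ratios_below_one q y (fun l => d l * (q ^ j) ^ l).
Proof.
  intros [rho [H1 H2]]. exists rho. split; [exact H1|].
  intros l Hl. apply H2. intros E. apply Hl. rewrite E. ring.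
Qed.

Lemma csum_rescaled_lattice (q z : C) (d : nat -> C) (f : C -> C) (j : nat) :
  (forall n, csum (fun l => d l * (q ^ n) ^ l) (f (z * q ^ n))) ->
  forall n, csum (fun l => d l * (q ^ j) ^ l * (q ^ n) ^ l) (f (z * q ^ j * q ^ n)).
Proof.
  intros H n. rewrite <- Cmult_assoc, <- Cpow_add_r.
  eapply csum_ext, H. intros l. cbv beta.
  rewrite Cpow_add_r, Cpow_mult_l. ring.
Qed.

Lemma qGamma_shift (Lg : C -> C) (q lam : C) (m : nat) :
  (0 < Cmod q < 1)%R -> (forall t : C, t <> 0 -> Cexp (Lg t) = t) ->
  qregular q (cpow Lg q lam) ->
  qGamma Lg q (lam + RtoC (INR m))
  = qGamma Lg q lam * (qpoch q (cpow Lg q lam) m / (1 - q) ^ m).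
Proof.
  intros Hq HL Hr. destruct (unit_disc_neq q Hq) as [Hq0 Hq1].
  unfold qGamma. rewrite (cpow_plus Lg q), (cpow_nat Lg HL q m Hq0).
  replace (1 - (lam + RtoC (INR m))) with ((1 - lam) + - RtoC (INR m)) by ring.
  rewrite (cpow_plus Lg (1 - q)), (cpow_opp Lg (1 - q)), (cpow_nat Lg HL _ m Hq1).
  rewrite (qpoch_inf_shift q (cpow Lg q lam) m (proj2 Hq)).
  assert (N1 := qpoch_neq0 q _ m Hr).
  assert (N2 := qpoch_inf_neq0 q _ (proj2 Hq) (qregular_shift q _ m Hr)).
  assert (N3 := Cpow_nz (1 - q) m Hq1).
  field. now repeat split.
Qed.

Lemma qGamma_neq0 (Lg : C -> C) (q lam : C) :
  (Cmod q < 1)%R -> qregular q (cpow Lg q lam) -> qGamma Lg q lam <> 0.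
Proof.
  intros Hq Hr. unfold qGamma.
  apply Cmult_neq_0; [|apply cpow_neq0].
  apply Cmult_neq_0; [|apply Cinv_neq0]; apply qpoch_inf_neq0; auto.
  now apply qregular_q.
Qed.

(** The inner Kober integral of order [m - mu] introduces the parameters [q^(nu+mu+1)]
    and [q^(nu+1+m)]; the m outer factors contribute [(q^(nu+1) q^l; q)_m], and
    [(y; q)_l (y q^l; q)_m = (y; q)_m (y q^m; q)_l], being [(y; q)_(l+m)] computed in two
    ways, converts the second parameter into [q^(nu+1)]. *)
Lemma kober_derivative_power_series (Lg : C -> C) (q nu mu : C) (f : C -> C) (z : C)
    (d : nat -> C) :
  (0 < Cmod q < 1)%R -> z <> 0 -> log_branch Lg q z ->
  qregular q (cpow Lg q (RtoC (INR (kober_order mu)) - mu)) ->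
  qregular q (cpow Lg q (nu + 1)) -> qregular q (cpow Lg q (nu + mu + 1)) ->
  (forall n, csum (fun l => d l * (q ^ n) ^ l) (f (z * q ^ n))) ->
  ratios_below_one q (cpow Lg q (nu + mu + 1)) d ->
  exists T : C,
    csum (fun l => d l * (qpoch q (cpow Lg q (nu + mu + 1)) l
                          / qpoch q (cpow Lg q (nu + 1)) l)) T
    /\ kober_derivative Lg q nu mu f z
       = qGamma Lg q (nu + mu + 1) / qGamma Lg q (nu + 1) * T.
Proof.
  intros Hq Hz HL Hm Hnu Hnumu Hf Hd.
  destruct (unit_disc_neq q Hq) as [Hq0 Hq1].
  unfold kober_derivative. cbv zeta.
  set (m := kober_order mu) in *.
  set (y := cpow Lg q (nu + 1)) in *. set (y' := cpow Lg q (nu + mu + 1)) in *.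
  assert (Ee : nu + mu + (RtoC (INR m) - mu) + 1 = (nu + 1) + RtoC (INR m)) by ring.
  assert (Ey : cpow Lg q ((nu + 1) + RtoC (INR m)) = y * q ^ m).
  { rewrite cpow_plus, (cpow_nat Lg (proj1 HL) q m Hq0). reflexivity. }
  set (G := qGamma Lg q (nu + mu + 1) / qGamma Lg q ((nu + 1) + RtoC (INR m))).
  set (e := fun l => G * (d l * (qpoch q y' l / qpoch q (y * q ^ m) l))).
  set (g := kober_integral Lg q (nu + mu) (RtoC (INR m) - mu) f).
  assert (Hg : forall j, csum (fun l => e l * (q ^ j) ^ l) (g (z * q ^ j))).
  { intros j.
    destruct (kober_integral_power_series Lg q (nu + mu) (RtoC (INR m) - mu) f
      (z * q ^ j) (fun l => d l * (q ^ j) ^ l)) as [T [HT HgT]]; auto.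
    - apply Cmult_neq_0; [exact Hz|now apply Cpow_nz].
    - now apply log_branch_shift.
    - rewrite Ee, Ey. now apply qregular_shift.
    - now apply csum_rescaled_lattice.
    - now apply ratios_rescaled.
    - unfold g. rewrite HgT, Ee. rewrite Ee, Ey in HT. fold G.
      eapply csum_ext, (csum_scal G _ _ HT).
      intros l. cbv beta. unfold e. fold y'. ring. }
  assert (HD := kober_factors_power_series Lg q nu z m Hq Hz HL e g Hg 0).
  rewrite Cmult_1_r in HD. fold y in HD.
  set (D := kober_factors Lg q nu m g z) in *.
  assert (N1 := qpoch_neq0 q y m Hnu).
  assert (N2 := Cpow_nz (1 - q) m Hq1).
  assert (N3 := qGamma_neq0 Lg q (nu + 1) (proj2 Hq) Hnu).
  assert (N4 := qGamma_neq0 Lg q (nu + mu + 1) (proj2 Hq) Hnumu).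
  assert (EG : G = qGamma Lg q (nu + mu + 1)
                   / (qGamma Lg q (nu + 1) * (qpoch q y m / (1 - q) ^ m))).
  { unfold G. now rewrite (qGamma_shift Lg q (nu + 1) m Hq (proj1 HL) Hnu). }
  exists (qGamma Lg q (nu + 1) / qGamma Lg q (nu + mu + 1) * D). split.
  - eapply csum_ext, (csum_scal (qGamma Lg q (nu + 1) / qGamma Lg q (nu + mu + 1)) _ _ HD).
    intros l. cbv beta. unfold e. rewrite EG, Cpow_1_l.
    assert (M1 := qpoch_neq0 q y l Hnu).
    assert (M2 := qpoch_neq0 q _ l (qregular_shift q y m Hnu)).
    assert (EQ : qpoch q (y * q ^ l) m
                 = qpoch q y m * qpoch q (y * q ^ m) l / qpoch q y l).
    { rewrite <- qpoch_add, Nat.add_comm, qpoch_add. field. exact M1. }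
    rewrite EQ. field. now repeat split.
  - field. now split.
Qed.

Theorem theorem18 (q : C) (Lg : C -> C) (r s : nat) (a b : list C)
    (alpha beta mu nu z : C)
    (hq : (0 < Cmod q < 1)%R)
    (hz : z <> 0)
    (hLg : log_branch Lg q z)
    (hr : (1 <= r)%nat) (hs : (1 <= s)%nat)
    (hlena : length a = r) (hlenb : length b = s)
    (ha : List.Forall (qregular q) a) (hb : List.Forall (qregular q) b)
    (hconv : Csummable (qR_term Lg q a b alpha beta z))
    (hmu : (0 < Re mu)%R)
    (hnu : qregular q (cpow Lg q (nu + 1)))
    (hnumu : qregular q (cpow Lg q (nu + mu + 1))) :
  (qregular q (cpow Lg q mu) ->
   jackson_integrable q
     (kober_integrand Lg q nu mu (qR Lg q a b alpha beta) z) z ->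
   Csummable (qR_term Lg q (a ++ cpow Lg q (nu + 1) :: nil)
                (b ++ cpow Lg q (nu + mu + 1) :: nil) alpha beta z) /\
   kober_integral Lg q nu mu (qR Lg q a b alpha beta) z =
     qGamma Lg q (nu + 1) / qGamma Lg q (nu + mu + 1) *
     qR Lg q (a ++ cpow Lg q (nu + 1) :: nil)
       (b ++ cpow Lg q (nu + mu + 1) :: nil) alpha beta z)
  /\
  (qregular q (cpow Lg q (RtoC (INR (kober_order mu)) - mu)) ->
   jackson_integrable q
     (kober_integrand Lg q (nu + mu) (RtoC (INR (kober_order mu)) - mu)
        (qR Lg q a b alpha beta) z) z ->
   Csummable (qR_term Lg q (a ++ cpow Lg q (nu + mu + 1) :: nil)
                (b ++ cpow Lg q (nu + 1) :: nil) alpha beta z) /\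
   kober_derivative Lg q nu mu (qR Lg q a b alpha beta) z =
     qGamma Lg q (nu + mu + 1) / qGamma Lg q (nu + 1) *
     qR Lg q (a ++ cpow Lg q (nu + mu + 1) :: nil)
       (b ++ cpow Lg q (nu + 1) :: nil) alpha beta z).
Proof.
  assert (Hf := fun n => qR_on_lattice Lg q a b alpha beta z n (proj2 hq) hconv).
  split; intros Hreg HJ.
  - assert (Hd := ratios_below_one_of_integrable _ _ _ _ _ _ _ hq hz hLg Hreg Hf HJ).
    destruct (kober_integral_power_series _ _ _ _ _ _ _ hq hz hLg Hreg hnu hnumu Hf Hd)
      as [T [HT ->]].
    apply (csum_ext _ (qR_term Lg q (a ++ cpow Lg q (nu + 1) :: nil)
      (b ++ cpow Lg q (nu + mu + 1) :: nil) alpha beta z)) in HT;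
      [|intros l; symmetry; now apply qR_term_snoc].
    split; [now apply csum_Csummable with T|].
    unfold qR. now rewrite (csum_CSeries _ _ HT).
  - assert (Hd := ratios_below_one_of_integrable _ _ _ _ _ _ _ hq hz hLg Hreg Hf HJ).
    destruct (kober_derivative_power_series _ _ _ _ _ _ _ hq hz hLg Hreg hnu hnumu Hf Hd)
      as [T [HT ->]].
    apply (csum_ext _ (qR_term Lg q (a ++ cpow Lg q (nu + mu + 1) :: nil)
      (b ++ cpow Lg q (nu + 1) :: nil) alpha beta z)) in HT;
      [|intros l; symmetry; now apply qR_term_snoc].
    split; [now apply csum_Csummable with T|].
    unfold qR. now rewrite (csum_CSeries _ _ HT).
Qed.
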